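(* Let $\mathcal L^{(1)},\dots,\mathcal L^{(M)}$ be $\mathcal L$-operators of the class $\mathfrak C$ (each with its own constants), let $\lambda_1,\dots,\lambda_M$ be constants, and let $\mathcal L(\lambda)$ be the monodromy matrix formed from $\mathcal L^{(1)}(\lambda_1+\lambda),\dots,\mathcal L^{(M)}(\lambda_M+\lambda)$. Define $$\begin{pmatrix}\alpha(\lambda)&\beta(\lambda)\\ \gamma(\lambda)&\delta(\lambda)\end{pmatrix}$$ to be the ordered product of the matrices $M_{\mathcal L^{(i)}}(\lambda_i+\lambda)$, taken in the same order as the monodromy matrix. Then the vacuum curve $\Gamma_{\mathcal L}(\lambda)$ of $\mathcal L(\lambda)$ is given by an equation of the form $$\Bigl(v^n-\frac{\alpha(\lambda)u^n+\beta(\lambda)}{\gamma(\lambda)u^n+\delta(\lambda)}\Bigr)^K=0$$ for some positive integer $K$.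
   Context: Fix $\eta=m\pi/n$ with $m,n$ relatively prime integers and $n$ odd. An $\mathcal L$-operator is a $2\times2$ matrix $\mathcal L(\lambda)=\begin{pmatrix}\mathcal A(\lambda)&\mathcal B(\lambda)\\ \mathcal C(\lambda)&\mathcal D(\lambda)\end{pmatrix}$ of operators on a finite-dimensional ''quantum space'' $V$, satisfying $R(\lambda-\mu)\mathcal L_1(\lambda)\mathcal L_2(\mu)=\mathcal L_2(\mu)\mathcal L_1(\lambda)R(\lambda-\mu)$ on $\mathbb C^2\otimes\mathbb C^2\otimes V$, where $R(\lambda)$ is the 6-vertex $R$-matrix on $\mathbb C^2\otimes\mathbb C^2$ with entries $R_{11,11}=R_{22,22}=\sin(\lambda+2\eta)$, $R_{12,12}=R_{21,21}=\sin\lambda$, $R_{12,21}=R_{21,12}=\sin2\eta$, all others $0$. The class $\mathfrak C$: $V=\mathbb C^n$; $\mathcal A(\lambda)=a\,\mathrm{diag}_{k=1}^n\sin(\lambda+\rho+(n+1-2k)\eta)$; $\mathcal D(\lambda)=d\,\mathrm{diag}_{k=1}^n\sin(\lambda+\sigma+(2k-1-n)\eta)$; $\mathcal B$ is the constant matrix whose only possibly nonzero entries are $b_{k,k-1}$ ($k=1,\dots,n$, indices mod $n$, so $b_{1,0}=b_{1n}$); $\mathcal C$ is the constant matrix whose only possibly nonzero entries are $c_{k-1,k}$ ($k=1,\dots,n$, indices mod $n$, so $c_{0,1}=c_{n1}$); here $a,d,\rho,\sigma,\Delta$ are constants and $b_{k,k-1}c_{k-1,k}=\Delta+\tfrac{ad}{2}\cos(\rho-\sigma+2\eta(n-2k))$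 for $k=1,\dots,n$. Vacuum curve of an $\mathcal L$-operator (or monodromy matrix) $\mathcal L(\lambda)$: $\Gamma_{\mathcal L}(\lambda)=\{(u,v)\in\mathbb C^2:\det(u\mathcal A(\lambda)+\mathcal B(\lambda)-uv\,\mathcal C(\lambda)-v\,\mathcal D(\lambda))=0\}$. For $\mathcal L\in\mathfrak C$ put $M_{\mathcal L}(\lambda)=\begin{pmatrix}\det\mathcal A(\lambda)&\det\mathcal B(\lambda)\\ \det\mathcal C(\lambda)&\det\mathcal D(\lambda)\end{pmatrix}$, regarded as defined up to multiplication by a nonzero meromorphic scalar function of $\lambda$; it is assumed that $\det M_{\mathcal L}\not\equiv0$. Monodromy matrix: given $\mathcal L$-operators $\mathcal L^{(i)}$ with quantum spaces $V_i$, the monodromy matrix is the ordered product (in a fixed order) of $\mathcal L^{(i)}(\lambda_i+\lambda)$ as $2\times2$ matrices with entries multiplied via tensor product, acting on $\mathbb C^2\otimes V_1\otimes\cdots\otimes V_M$.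
   Formalization: As printed, the constraint on b_{k,k-1}c_{k-1,k} contradicts the RLL relation and the claim fails (n=3, M=1, generic constants with ad≠0); it is proved with cos(ρ−σ+2η(n−2(k−1))) in place of cos(ρ−σ+2η(n−2k)). *)

(* Defs.v *)
From HB Require Import structures.
From mathcomp Require Import all_boot all_order all_algebra.
From mathcomp Require Import all_classical all_reals all_analysis.
From mathcomp Require Import complex mxtens.

Set Implicit Arguments.
Unset Strict Implicit.
Unset Printing Implicit Defensive.

Import Order.TTheory GRing.Theory Num.Theory.
Local Open Scope ring_scope.
Local Open Scope complex_scope.

Section Defs.
Variable R : realType.
Local Notation C := R[i].

Definition rcosh (y : R) : R := (expR y + expR (- y)) / 2.
Definition rsinh (y : R) : R := (expR y - expR (- y)) / 2.

Definition csin (z : C) : C :=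
  (sin (complex.Re z) * rcosh (complex.Im z)) +i* (cos (complex.Re z) * rsinh (complex.Im z)).
Definition ccos (z : C) : C :=
  (cos (complex.Re z) * rcosh (complex.Im z)) +i* (- (sin (complex.Re z) * rsinh (complex.Im z))).

Definition eta (m : int) (n : nat) : C := ((m%:~R * pi) / n%:R)%:C.

(* Constants of an L-operator of the class 𝔆 (indices 0-based:
   ordinal i : 'I_n stands for the paper's k = i+1). *)
Record CData (n : nat) := MkCData {
  ca : C; cd : C; crho : C; csig : C; cDel : C;
  cb : 'I_n -> C;   (* cb i = b_{k,k-1},  k = i+1 *)
  cc : 'I_n -> C    (* cc i = c_{k-1,k},  k = i+1 *)
}.

(* 2x2 matrices of operators on C^N (an "L-operator" evaluated at some lambda) *)
Record Quad (N : nat) := MkQuad {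
  qA : 'M[C]_N; qB : 'M[C]_N; qC : 'M[C]_N; qD : 'M[C]_N }.

Section ClassC.
Variables (m : int) (n : nat).
Local Notation et := (eta m n).

Definition classC (p : CData n) : Prop :=
  forall i : 'I_n,
    cb p i * cc p i =
    cDel p + ca p * cd p / 2%:R *
      ccos (crho p - csig p + 2%:R * et * (n%:R - 2%:R * (val i)%:R)).

Definition Lop (p : CData n) (lam : C) : Quad n :=
  MkQuad
    (* A = a diag_k sin(lam + rho + (n+1-2k) eta),  k = i+1 *)
    (diag_mx (\row_(i < n)
       (ca p * csin (lam + crho p + (n%:R - 1 - 2%:R * (val i)%:R) * et))))
    (* B: only entries b_{k,k-1} (row k, column k-1 mod n) *)
    (\matrix_(i < n, j < n)
       (if val j == ((val i + n.-1) %% n)%N then cb p i else 0))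
    (* C: only entries c_{k-1,k} (row k-1 mod n, column k) *)
    (\matrix_(i < n, j < n)
       (if val i == ((val j + n.-1) %% n)%N then cc p j else 0))
    (* D = d diag_k sin(lam + sigma + (2k-1-n) eta) *)
    (diag_mx (\row_(i < n)
       (cd p * csin (lam + csig p + (2%:R * (val i)%:R + 1 - n%:R) * et)))).

Definition ML (p : CData n) (lam : C) : 'M[C]_2 :=
  let L := Lop p lam in
  \matrix_(i < 2, j < 2)
    (if val i == 0%N then (if val j == 0%N then \det (qA L) else \det (qB L))
     else (if val j == 0%N then \det (qC L) else \det (qD L))).

End ClassC.

Definition qmul N1 N2 (X : Quad N1) (Y : Quad N2) : Quad (N1 * N2) :=
  MkQuad (qA X *t qA Y + qB X *t qC Y) (qA X *t qB Y + qB X *t qD Y)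
         (qC X *t qA Y + qD X *t qC Y) (qC X *t qB Y + qD X *t qD Y).

Definition castQ N1 N2 (e : N1 = N2) (X : Quad N1) : Quad N2 :=
  MkQuad (castmx (e, e) (qA X)) (castmx (e, e) (qB X))
         (castmx (e, e) (qC X)) (castmx (e, e) (qD X)).

Definition Quad1 : Quad 1 := MkQuad 1%:M 0 0 1%:M.

Fixpoint mono (m : int) (n : nat) (ls : seq (CData n * C)) (lam : C)
  : Quad (n ^ size ls) :=
  match ls as ls0 return Quad (n ^ size ls0) with
  | [::] => Quad1
  | (p, l) :: ls' =>
      castQ (esym (expnS n (size ls'))) (qmul (Lop m p (l + lam)) (mono m ls' lam))
  end.

Fixpoint Mprod (m : int) (n : nat) (ls : seq (CData n * C)) (lam : C) : 'M[C]_2 :=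
  match ls with
  | [::] => 1%:M
  | (p, l) :: ls' => ML m p (l + lam) *m Mprod m ls' lam
  end.

Definition vacdet N (L : Quad N) (u v : C) : C :=
  \det (u *: qA L + qB L - (u * v) *: qC L - v *: qD L).

Definition vacuum_curve N (L : Quad N) : set (C * C) :=
  [set uv | vacdet L uv.1 uv.2 = 0].

Definition ent00 (X : 'M[C]_2) := X ord0 ord0.
Definition ent01 (X : 'M[C]_2) := X ord0 ord_max.
Definition ent10 (X : 'M[C]_2) := X ord_max ord0.
Definition ent11 (X : 'M[C]_2) := X ord_max ord_max.

End Defs.

(* Main.v *)
(* In homogeneous form the equation of the vacuum curve is the vanishing of
   det (p (u1 A + u2 B) + q (u1 C + u2 D)), taken at (p, q) = (1, - v) and
   (u1, u2) = (u, 1).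

   One factor.  Write w = e^(2 i eta), a primitive n-th root of unity, Z = diag
   (w^k) and S for the cyclic shift, so that Z S = w S Z.  After a diagonal
   conjugation, A and D are combinations of Z and Z^-1, B is one of Z S and
   Z^-1 S, and C is one of Z S^-1 and Z^-1 S^-1.  If det (x M1 + M2) is invariant
   under x -> w x, then det (M1 + M2) = det M1 + det M2.  This separates the Z
   part from the Z^-1 part, since conjugation by S multiplies them by inverse
   powers of w.  Each part is Z^(+-1) times a product
   (r1 + r2 S) (r3 + r4 S^-1), and the same principle, for conjugation by Z,
   evaluates both factors.

   Products.  The pencil of a product is P (x) S + Q (x) T.  Triangularizing the
   pencil (P, Q), with diagonal entries (p_i, q_i), its determinant is
   \prod_i det (p_i S + q_i T), a resultant in which the coefficients combine
   as in the product of the 2 x 2 matrices. *)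
Require Import Defs.
From HB Require Import structures.
From mathcomp Require Import all_boot all_order all_fingroup all_algebra.
From mathcomp Require Import all_classical all_reals all_analysis.
From mathcomp Require Import complex mxtens ring lra zify.
From Stdlib Require List.
Import Order.TTheory GRing.Theory Num.Theory.
Local Open Scope ring_scope.

Set Implicit Arguments.
Unset Strict Implicit.
Unset Printing Implicit Defensive.

(** * Determinant pencils invariant under a root of unity *)

Section RootOfUnity.
Variable F : numFieldType.
Implicit Type n : nat.

Lemma prod_linear_poly n (a b : 'I_n -> F) :
  let p := \prod_i ((a i)%:P * 'X + (b i)%:P) in
  (size p <= n.+1)%N /\ p`_n = \prod_i a i.
Proof.
elim: n a b => [|n IHn] a b /=.
  by rewrite !big_ord0 size_poly1 coef1.
rewrite !big_ord_recl; set p := \prod_(i < n) _.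
have [sp cp] := IHn (fun i => a (lift ord0 i)) (fun i => b (lift ord0 i)).
split.
  apply: leq_trans (size_polyMleq _ _) _.
  have : (size ((a ord0)%:P * 'X + (b ord0)%:P)%R <= 2)%N.
    by rewrite size_MXaddC; case: ifP => // _; rewrite ltnS size_polyC; case: eqP.
  by move=> s2; have := leq_add s2 sp; rewrite -/p; case: (_ + _)%N.
rewrite mulrDl coefD -mulrA !coefCM coefXM /= cp.
by rewrite [p`_n.+1]nth_default // mulr0 addr0.
Qed.

Lemma det_pencil_poly n (M1 M2 : 'M[F]_n) :
  exists p : {poly F}, [/\ (size p <= n.+1)%N, p`_n = \det M1
    & forall x, p.[x] = \det (x *: M1 + M2)].
Proof.
pose N := \matrix_(i, j) ((M1 i j)%:P * 'X + (M2 i j)%:P).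
exists (\det N); split.
- apply: (leq_trans (size_sum _ _ _)); apply/bigmax_leqP => s _.
  have -> : (-1) ^+ s = ((-1) ^+ s)%:P :> {poly F} by rewrite rmorphXn rmorphN1.
  apply: (@leq_trans (size (\prod_i N i (s i)))).
    by rewrite mul_polyC size_scale_leq.
  under eq_bigr do rewrite mxE.
  by have [] := prod_linear_poly (fun i => M1 i (s i)) (fun i => M2 i (s i)).
- rewrite coef_sum; apply: eq_bigr => s _.
  have -> : (-1) ^+ s = ((-1) ^+ s)%:P :> {poly F} by rewrite rmorphXn rmorphN1.
  rewrite coefCM; congr (_ * _).
  under eq_bigr do rewrite mxE.
  by have [] := prod_linear_poly (fun i => M1 i (s i)) (fun i => M2 i (s i)).
- move=> x; rewrite -[_.[x]]/(horner_eval x _) -det_map_mx; congr (\det _).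
  apply/matrixP => i j; rewrite !mxE.
  rewrite -[LHS]/(horner _ x).
  by rewrite hornerD hornerM hornerX !hornerC mulrC.
Qed.

Lemma poly_eq0_nat (p : {poly F}) :
  (forall k : nat, p.[k%:R] = 0) -> p = 0.
Proof.
move=> p0; apply/eqP/negPn/negP => nzp.
have := max_poly_roots (rs := [seq k%:R | k <- iota 0 (size p)]) nzp.
rewrite size_map size_iota ltnn => H; suff : false by []; apply: H.
  by apply/allP => x /mapP [k _ ->]; rewrite /root p0.
rewrite map_inj_uniq ?iota_uniq //.
by move=> i j /eqP; rewrite eqr_nat => /eqP.
Qed.

(* The polynomial [det (x M1 + M2)] has degree at most [n] and is invariant
   under [x -> w x], so only its constant and its top coefficient survive. *)
Lemma det_add_twisted n (w : F) (M1 M2 : 'M[F]_n) :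
  n.-primitive_root w ->
  (forall x, \det (x *: M1 + M2) = \det ((w * x) *: M1 + M2)) ->
  \det (M1 + M2) = \det M1 + \det M2.
Proof.
move=> w_prim Hw; have n_gt0 := prim_order_gt0 w_prim.
have [p [sp pn pE]] := det_pencil_poly M1 M2.
have pw : p - (p \Po (w *: 'X)) = 0.
  apply: poly_eq0_nat => // k.
  by rewrite hornerD hornerN horner_comp hornerZ hornerX !pE -Hw subrr.
(* Comparing coefficients in [pw] gives [p_j = p_j w^j], and [w^j = 1] only when [n] divides [j]. *)
have p0 j : (0 < j < n)%N -> p`_j = 0.
  case/andP=> j0 jn; have := congr1 (coefp j) pw.
  rewrite /= coefB comp_polyE coef_sum coef0.
  have -> : \sum_(i < size p) (p`_i *: (w *: 'X) ^+ i)`_j = p`_j * w ^+ j.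
    rewrite (eq_bigr (fun i : 'I__ => p`_i * w ^+ i * (j == i)%:R)); last first.
      by move=> i _; rewrite exprZn !coefZ coefXn mulrA.
    case: (ltnP j (size p)) => jp.
      rewrite (bigD1 (Ordinal jp)) //= eqxx mulr1 big1 ?addr0 // => i.
      rewrite -val_eqE /= eq_sym => /negPf ->; exact: mulr0.
    rewrite big1 ?[p`_j]nth_default ?mul0r // => i _.
    by rewrite gtn_eqF ?mulr0 //; apply: leq_trans jp.
  move/eqP; rewrite -{1}[p`_j]mulr1 -mulrBr mulf_eq0 => /orP[/eqP //|].
  rewrite subr_eq0 eq_sym -(prim_order_dvd w_prim) => /dvdn_leq.
  by move=> /(_ j0); rewrite leqNgt jn.
have -> : \det (M1 + M2) = p.[1] by rewrite pE scale1r.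
have -> : \det M2 = p.[0] by rewrite pE scale0r add0r.
rewrite -pn horner_coef0 (horner_coef_wide _ sp) big_ord_recr /=.
case: n n_gt0 {M1 M2 Hw w_prim pE pn} sp p0 => // n _ sp p0.
rewrite big_ord_recl big1 => [|i _]; last by rewrite p0 ?mul0r //= ltnS.
by rewrite !expr1n !mulr1 addr0 addrC.
Qed.

End RootOfUnity.

(** * Determinants of Kronecker products *)

Section TensorDet.
Variable R : comPzRingType.

Lemma castmxD m n m' n' (e : (m = m') * (n = n')) (A B : 'M[R]_(m, n)) :
  castmx e (A + B) = castmx e A + castmx e B.
Proof. by case: e => e1 e2; case: m' / e1; case: n' / e2. Qed.

Lemma det_castmx m n (e1 e2 : m = n) (A : 'M[R]_m) :
  \det (castmx (e1, e2) A) = \det A.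
Proof. by case: n / e1 e2 => e2; rewrite (eq_axiomK e2) castmx_id. Qed.

Lemma det_reindex m n (f : 'I_m -> 'I_n) (A : 'M[R]_n) :
  bijective f -> \det (\matrix_(i, j) A (f i) (f j)) = \det A.
Proof.
move=> f_bij; have /eqP := bij_eq_card f_bij; rewrite !card_ord => /eqP emn.
case: n / emn in f A f_bij *; have f_inj := bij_inj f_bij.
have -> : \matrix_(i, j) A (f i) (f j)
        = row_perm (perm f_inj) (col_perm (perm f_inj) A).
  by apply/matrixP => i j; rewrite !mxE !permE.
rewrite row_permE col_permE !det_mulmx !det_perm odd_permV mulrCA mulrA.
by rewrite -mulrA -signr_addb addbb mulr1.
Qed.

Lemma det_tens1mx k n (A : 'M[R]_n) :
  \det ((1%:M : 'M[R]_k) *t A) = \det A ^+ k.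
Proof.
elim: k => [|k IHk]; first by rewrite det_mx00.
rewrite -[k.+1]add1n -[1%:M]/(1%:M : 'M[R]_(1 + k)) scalar_mx_block tens_block_mx det_castmx.
rewrite tens0mx det_lblock IHk exprS; congr (_ * _).
by rewrite tens_scalar1mx det_castmx.
Qed.

Lemma det_tensmx1 k n (A : 'M[R]_n) :
  \det (A *t (1%:M : 'M[R]_k)) = \det A ^+ k.
Proof.
rewrite -det_tens1mx.
(* Swapping the two tensor factors turns [A *t 1] into [1 *t A] by one permutation of both rows and
   columns, so no sign appears. *)
pose f (x : 'I_(k * n)) := let: (i, j) := mxtens_unindex x in mxtens_index (j, i).
pose g (x : 'I_(n * k)) := let: (i, j) := mxtens_unindex x in mxtens_index (j, i).
have f_bij : bijective f.
  by exists g => x; case: (mxtens_indexP x) => i j; rewrite /f /g !mxtens_indexK.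
rewrite -(det_reindex _ f_bij); congr (\det _); apply/matrixP => x y.
case: (mxtens_indexP x) => i j; case: (mxtens_indexP y) => i' j'.
by rewrite mxE /f !mxtens_indexK !tensmxE mulrC.
Qed.

End TensorDet.

(** * Simultaneous triangularization of a matrix pencil *)

Section Pencil.
Variable F : numClosedFieldType.

(* A common deflating line: [x] is in the kernel of [P], or an eigenvector of
   [Q P^-1]. *)
Lemma pencil_deflate n (P Q : 'M[F]_n.+1) :
  exists (x y : 'rV[F]_n.+1) (p q : F),
    [/\ x != 0, y != 0, x *m P = p *: y & x *m Q = q *: y].
Proof.
have ex0 : exists y : 'rV[F]_n.+1, y != 0.
  by exists (const_mx 1); apply/eqP => /rowP/(_ 0); rewrite !mxE => /eqP; rewrite oner_eq0.
have [uP|nuP] := boolP (P \in unitmx).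
  have [a /eigenvalueP [x xa nzx]] := eigenvalue_closed (Q *m invmx P) (ltn0Sn n).
  exists x, (x *m P), 1, a; split=> //; last 2 first.
  - by rewrite scale1r.
  - by rewrite scalemxAl -xa mulmxA mulmxKV.
  by apply: contra nzx => /eqP xP; rewrite -[x](mulmxK uP) xP mul0mx.
have [x nzx xP] : exists2 x : 'rV[F]_n.+1, x != 0 & x *m P = 0.
  apply/det0P; move: nuP; rewrite unitmxE unitfE negbK => /eqP ->//.
have [xQ|nzxQ] := eqVneq (x *m Q) 0.
  by have [y nzy] := ex0; exists x, y, 0, 0; rewrite !scale0r.
by exists x, (x *m Q), 0, 1; rewrite scale0r scale1r.
Qed.

Lemma unitmx_row0 n (x : 'rV[F]_(1 + n)) : x != 0 ->
  exists2 U : 'M[F]_(1 + n), U \in unitmx & delta_mx 0 0 *m U = x.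
Proof.
move=> nzx; pose e0 : 'rV[F]_(1 + n) := delta_mx 0 0.
have e0x : e0 *m (e0^T *m x) = x.
  by rewrite mulmxA trmx_delta mul_delta_mx -[RHS]mul1mx; congr (_ *m _);
     apply/rowP=> i; rewrite !mxE !ord1.
have [|U uU xU] := @complete_unitmx F 1 (1 + n) e0 (e0^T *m x).
  by rewrite e0x mxrank_delta rank_rV nzx.
by exists U; rewrite // -[LHS]xU.
Qed.

Lemma row0_block n (N : 'M[F]_(1 + n)) p :
  delta_mx 0 0 *m N = p *: (delta_mx 0 0 : 'rV[F]_(1 + n)) ->
  N = block_mx p%:M 0 (dlsubmx N) (drsubmx N).
Proof.
rewrite -rowE => /rowP N0; rewrite -[LHS]submxK; congr block_mx;
  apply/matrixP => i j; rewrite !ord1 !mxE.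
  have := N0 0; rewrite !mxE !eqxx mulr1 => <-.
  by congr (N _ _); apply: val_inj.
have := N0 (rshift 1 j); rewrite !mxE andbF mulr0 => <-.
by congr (N _ _); apply: val_inj.
Qed.

(** Bases starting with the deflating vectors [x] and [y] make [P] and [Q] block lower triangular at
    once, with corners [p] and [q]; induction handles the remaining blocks. One list serves both
    formulas, so the scalar pencil determines the symmetric data needed for the tensor one. *)
Lemma det_tens_pencil n (P Q : 'M[F]_n) :
  exists2 l : seq (F * F), size l = n &
    (forall x y, \det (x *: P + y *: Q) = \prod_(pq <- l) (pq.1 * x + pq.2 * y)) /\
    (forall k (S T : 'M[F]_k),
       \det (P *t S + Q *t T) = \prod_(pq <- l) \det (pq.1 *: S + pq.2 *: T)).
Proof.
elim: n P Q => [|n IHn] P Q.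
  by exists [::] => //; split=> *; rewrite big_nil det_mx00.
have [x [y [p [q [nzx nzy xP xQ]]]]] := pencil_deflate P Q.
have [U uU Ux] := unitmx_row0 nzx; have [V uV Vy] := unitmx_row0 nzy.
have nzU : \det U != 0 by rewrite -unitfE -unitmxE.
have nzV : \det V != 0 by rewrite -unitfE -unitmxE.
have yV : y *m invmx V = delta_mx 0 0 by rewrite -Vy mulmxK.
have /row0_block : delta_mx 0 0 *m (U *m P *m invmx V) = p *: (delta_mx 0 0 : 'rV[F]_(1 + n)).
  by rewrite !mulmxA Ux xP -scalemxAl yV.
have /row0_block : delta_mx 0 0 *m (U *m Q *m invmx V) = q *: (delta_mx 0 0 : 'rV[F]_(1 + n)).
  by rewrite !mulmxA Ux xQ -scalemxAl yV.
move: (dlsubmx _) (drsubmx _) => Q1 Q2 QE; move: (dlsubmx _) (drsubmx _) => P1 P2 PE.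
have [l sl [lE ltE]] := IHn P2 Q2.
(* The base changes multiply the determinant by [k], or by [k ^+ d] in the tensor case. Scaling a
   single pair by [k] absorbs both, since its factor there is a determinant of size [d]. *)
pose k := \det V / \det U; exists ((k * p, k * q) :: l); first by rewrite /= sl.
split=> [a b|d S T]; rewrite big_cons /=.
  have : \det U * \det (a *: P + b *: Q) / \det V
       = (a * p + b * q) * \prod_(pq <- l) (pq.1 * a + pq.2 * b).
    rewrite -det_inv -!det_mulmx mulmxDr mulmxDl -!scalemxAr -!scalemxAl PE QE.
    rewrite !scale_block_mx add_block_mx !scaler0 addr0 det_lblock lE.
    by rewrite det_mx11 !mxE !mulr1n.
  move=> H; rewrite /k; apply: (mulfI nzU); apply: (divIf nzV); rewrite H.
  by field; rewrite nzU nzV.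
have : \det U ^+ d * \det (P *t S + Q *t T) / \det V ^+ d
     = \det (p *: S + q *: T) * \prod_(pq <- l) \det (pq.1 *: S + pq.2 *: T).
  rewrite -exprVn -det_inv -!(det_tensmx1 d) -!det_mulmx mulmxDr mulmxDl.
  rewrite !tensmx_mul !mul1mx !mulmx1 PE QE !tens_block_mx -castmxD !tens0mx.
  rewrite add_block_mx addr0 det_castmx det_lblock ltE; congr (_ * _).
  by rewrite !tens_scalar_mx -castmxD det_castmx.
move=> H; apply: (mulfI (expf_neq0 d nzU)); apply: (divIf (expf_neq0 d nzV)).
have -> : (k * p) *: S + (k * q) *: T = k *: (p *: S + q *: T).
  by rewrite scalerDr !scalerA.
rewrite H detZ expr_div_n.
by field; rewrite !expf_neq0.
Qed.
End Pencil.

(** * Determinants on the Segre quadric *)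

(** A singular 2 x 2 matrix is an outer product, here of [(r1, r2)] and [(r3, r4)]. *)
Lemma rank1_factor (F : fieldType) (e1 e2 e3 e4 : F) : e1 * e4 = e2 * e3 ->
  exists r1 r2 r3 r4 : F, [/\ e1 = r1 * r3, e2 = r2 * r3, e3 = r1 * r4 & e4 = r2 * r4].
Proof.
have [->|nz1] := eqVneq e1 0 => e14.
  have [->|nz2] := eqVneq e2 0.
    by exists e3, e4, 0, 1; rewrite !mulr0 !mulr1.
  have -> : e3 = 0 by apply: (mulfI nz2); rewrite -e14 mul0r mulr0.
  by exists 0, 1, e2, e4; rewrite !mul0r !mul1r.
exists e1, e2, 1, (e3 / e1); rewrite !mulr1; split=> //.
  by rewrite mulrC divfK.
by rewrite mulrA -e14 mulrC mulKf.
Qed.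

(* The pencil [x1 A + x2 B + x3 C + x4 D] restricted to the Segre quadric
   [x1 x4 = x2 x3], on which [(u, 1, - u v, - v)] lies. *)
Definition segre_det (F : fieldType) n (A B C D : 'M[F]_n) :=
  forall x1 x2 x3 x4, x1 * x4 = x2 * x3 ->
  \det (x1 *: A + x2 *: B + x3 *: C + x4 *: D) =
  x1 ^+ n * \det A + x2 ^+ n * \det B + x3 ^+ n * \det C + x4 ^+ n * \det D.

(** The four coordinate vectors lie on the quadric, and evaluating there identifies the
    coefficients. *)
Lemma segre_det_coef (F : fieldType) n (A B C D : 'M[F]_n) (al be ga de : F) :
  (0 < n)%N ->
  (forall x1 x2 x3 x4, x1 * x4 = x2 * x3 ->
   \det (x1 *: A + x2 *: B + x3 *: C + x4 *: D) =
   x1 ^+ n * al + x2 ^+ n * be + x3 ^+ n * ga + x4 ^+ n * de) ->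
  segre_det A B C D.
Proof.
move=> n_gt0 H x1 x2 x3 x4 /H ->.
have := H 1 0 0 0; have := H 0 1 0 0; have := H 0 0 1 0; have := H 0 0 0 1.
rewrite !(mul0r, mulr0) !scale1r !scale0r !(addr0, add0r).
rewrite !expr1n !expr0n (gtn_eqF n_gt0) !(mul0r, mul1r, addr0, add0r).
by do 4!move=> /(_ erefl) ->.
Qed.

Lemma mulmx1_det_neq0 (F : fieldType) n (A B : 'M[F]_n) :
  A *m B = 1%:M -> \det A != 0.
Proof. by case/mulmx1_unit; rewrite unitmxE unitfE. Qed.

(** * Determinants in q-commuting matrices *)

Section Weyl.
Variables (F : fieldType) (n : nat) (q : F).
Variables (Z Z' S S' : 'M[F]_n).
Hypotheses (SS' : S *m S' = 1%:M) (ZZ' : Z *m Z' = 1%:M) (ZS : Z *m S = q *: (S *m Z)).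

Lemma weyl_ZS' : S' *m Z = q *: (Z *m S').
Proof.
have S'S := mulmx1C SS'.
rewrite -[LHS]mulmx1 -SS' -mulmxA [Z *m _]mulmxA ZS -scalemxAl -scalemxAr.
by rewrite !mulmxA S'S mul1mx.
Qed.

Lemma weyl_Z'S' : Z' *m S' = q *: (S' *m Z').
Proof.
have Z'Z := mulmx1C ZZ'.
rewrite -[LHS]mulmx1 -ZZ' -mulmxA [S' *m _]mulmxA weyl_ZS' -scalemxAl -scalemxAr.
by rewrite !mulmxA Z'Z mul1mx.
Qed.

Lemma weyl_SZ' : S *m Z' = q *: (Z' *m S).
Proof.
have Z'Z := mulmx1C ZZ'.
rewrite -[LHS]mul1mx -Z'Z -mulmxA [Z *m _]mulmxA ZS -scalemxAl -scalemxAr.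
by rewrite -[S *m Z *m Z']mulmxA ZZ' mulmx1.
Qed.
End Weyl.

(** Conjugation by [Z] replaces [S] by [q *: S], so the determinant is unchanged when [r2] is
    multiplied by [q]. *)
Lemma det_binomial (F : numFieldType) n (q : F) (Z S : 'M[F]_n) (r1 r2 : F) :
  n.-primitive_root q -> \det Z != 0 -> Z *m S = q *: (S *m Z) ->
  \det (r1%:M + r2 *: S) = r1 ^+ n + r2 ^+ n * \det S.
Proof.
move=> q_prim nzZ ZS; rewrite addrC (det_add_twisted q_prim) => [|x].
  by rewrite det_scalar detZ addrC.
apply: (mulfI nzZ); rewrite mulrC [RHS]mulrC -[LHS]mulrC -!det_mulmx.
congr (\det _); rewrite mulmxDr mulmxDl scalar_mxC -!scalemxAr ZS -!scalemxAl.
by rewrite !scalerA; congr (_ *: _ + _); ring.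
Qed.

Section Core.
Variables (F : numFieldType) (n : nat) (q : F).
Hypothesis q_prim : n.-primitive_root q.
Hypothesis n_odd : odd n.
Variables (Z Z' S S' : 'M[F]_n).
Hypotheses (SS' : S *m S' = 1%:M) (ZZ' : Z *m Z' = 1%:M) (ZS : Z *m S = q *: (S *m Z)).

Lemma det_trinomial e1 e2 e3 e4 : e1 * e4 = e2 * e3 ->
  \det ((e1 + e4)%:M + e2 *: S + e3 *: S')
  = e1 ^+ n + e4 ^+ n + e2 ^+ n * \det S + e3 ^+ n * \det S'.
Proof.
case/rank1_factor => r1 [r2 [r3 [r4 [-> -> -> ->]]]].
have dSS' : \det S * \det S' = 1 by rewrite -det_mulmx SS' det1.
have nzZ : \det Z != 0 by apply: mulmx1_det_neq0 ZZ'.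
have nzZ' : \det Z' != 0 by apply: mulmx1_det_neq0 (mulmx1C ZZ').
have -> : (r1 * r3 + r2 * r4)%:M + (r2 * r3) *: S + (r1 * r4) *: S'
        = (r1%:M + r2 *: S) *m (r3%:M + r4 *: S').
  rewrite mulmxDl !mulmxDr -!scalemxAl -!scalemxAr SS' !mul_scalar_mx mul_mx_scalar.
  rewrite !scale_scalar_mx !scalerA mulr1 raddfD /=.
  by rewrite [r4 * r1]mulrC [RHS]addrAC [_ *: S + _]addrC !addrA.
rewrite det_mulmx (det_binomial _ _ q_prim nzZ ZS).
(* For the factor in [S'], conjugation by [Z'] plays the role of conjugation by [Z]. *)
rewrite (det_binomial _ _ q_prim nzZ' (weyl_Z'S' SS' ZZ' ZS)).
rewrite !exprMn mulrDl !mulrDr.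
have -> : r2 ^+ n * \det S * (r4 ^+ n * \det S') = r2 ^+ n * r4 ^+ n * (\det S * \det S').
  by ring.
by rewrite dSS'; ring.
Qed.

(** On the quadric, the two hypotheses are exactly the rank-one conditions of [det_trinomial] for
    the [Z] part and the [Z'] part. *)
Lemma weyl_segre_det a1 a2 b1 b2 c1 c2 d1 d2 :
  a1 * d1 = q * b1 * c1 -> q * a2 * d2 = b2 * c2 ->
  segre_det (a1 *: Z + a2 *: Z') ((b1 *: Z + b2 *: Z') *m S)
            (S' *m (c1 *: Z + c2 *: Z')) (d1 *: Z + d2 *: Z').
Proof.
move=> ad1 ad2; have n_gt0 := prim_order_gt0 q_prim.
have nzq : q != 0 by rewrite (prim_root_eq0 q_prim) -lt0n.
have qn := prim_expr_order q_prim.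
have S'Z : S' *m Z = q *: (Z *m S') := weyl_ZS' SS' ZS.
have S'Z' : S' *m Z' = q^-1 *: (Z' *m S').
  by rewrite (weyl_Z'S' SS' ZZ' ZS) scalerA mulVf // scale1r.
have SZ' : S *m Z' = q *: (Z' *m S) := weyl_SZ' ZZ' ZS.
have SZ : S *m Z = q^-1 *: (Z *m S) by rewrite ZS scalerA mulVf // scale1r.
have dSS' : \det S * \det S' = 1 by rewrite -det_mulmx SS' det1.
have nzS : \det S != 0 by apply: mulmx1_det_neq0 SS'.
(* Conjugation by [S] scales the two parts by [q^-1] and [q]. Their ratio [q ^+ 2] is still
   primitive because [n] is odd. *)
have q2_prim : n.-primitive_root (q ^+ 2).
  by rewrite (prim_root_exp_coprime _ q_prim) coprime2n.
(* [J1] and [J2] collect the terms in [Z] and in [Z']; the extra factors [q] and [q^-1] come from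
   moving [S'] to the right. *)
pose J1 x1 x2 x3 x4 := Z *m ((x1 * a1 + x4 * d1)%:M + (x2 * b1) *: S + (x3 * c1 * q) *: S').
pose J2 x1 x2 x3 x4 := Z' *m ((x1 * a2 + x4 * d2)%:M + (x2 * b2) *: S + (x3 * c2 / q) *: S').
apply: (@segre_det_coef _ _ _ _ _ _
  (\det Z * a1 ^+ n + \det Z' * a2 ^+ n)
  (\det Z * b1 ^+ n * \det S + \det Z' * b2 ^+ n * \det S)
  (\det Z * c1 ^+ n * \det S' + \det Z' * c2 ^+ n * \det S')
  (\det Z * d1 ^+ n + \det Z' * d2 ^+ n)) => // x1 x2 x3 x4 x14.
have -> : x1 *: (a1 *: Z + a2 *: Z') + x2 *: ((b1 *: Z + b2 *: Z') *m S) +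
   x3 *: (S' *m (c1 *: Z + c2 *: Z')) + x4 *: (d1 *: Z + d2 *: Z')
   = J2 x1 x2 x3 x4 + J1 x1 x2 x3 x4.
  rewrite /J1 /J2 !mulmxDr mulmxDl -!scalemxAl -!scalemxAr S'Z S'Z' !mul_mx_scalar.
  rewrite !scalerDr !scalerDl !scalerA.
  move: (Z *m S) (Z' *m S) (Z *m S') (Z' *m S') => ZS0 Z'S0 ZS'0 Z'S'0.
  apply/matrixP => i j; rewrite !mxE; ring.
have SJ1 : S *m J1 x1 x2 x3 x4 = q^-1 *: (J1 x1 x2 x3 x4 *m S).
  rewrite /J1 mulmxA SZ -!scalemxAl; congr (_ *: _); rewrite -!mulmxA; congr (_ *m _).
  by rewrite !mulmxDr !mulmxDl -!scalemxAl -!scalemxAr SS' (mulmx1C SS') scalar_mxC.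
have SJ2 : S *m J2 x1 x2 x3 x4 = q *: (J2 x1 x2 x3 x4 *m S).
  rewrite /J2 mulmxA SZ' -!scalemxAl; congr (_ *: _); rewrite -!mulmxA; congr (_ *m _).
  by rewrite !mulmxDr !mulmxDl -!scalemxAl -!scalemxAr SS' (mulmx1C SS') scalar_mxC.
rewrite (det_add_twisted q2_prim) => [|x]; last first.
  apply: (mulfI nzS); rewrite -det_mulmx mulmxDr -scalemxAr SJ1 SJ2 scalerA.
  have -> : (x * q) *: (J2 x1 x2 x3 x4 *m S) + q^-1 *: (J1 x1 x2 x3 x4 *m S)
     = q^-1 *: (((q ^+ 2 * x) *: J2 x1 x2 x3 x4 + J1 x1 x2 x3 x4) *m S).
    rewrite mulmxDl -scalemxAl scalerDr scalerA; congr (_ *: _ + _).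
    by field.
  by rewrite detZ det_mulmx exprVn qn invr1 mul1r mulrC.
rewrite !det_mulmx !det_trinomial; last 2 first.
- have -> : x1 * a1 * (x4 * d1) = (x1 * x4) * (a1 * d1) by ring.
  by rewrite x14 ad1; ring.
- have -> : x1 * a2 * (x4 * d2) = (x1 * x4) * (q * a2 * d2) / q by field.
  by rewrite x14 ad2; field.
by rewrite !exprMn exprVn qn invr1; ring.
Qed.
End Core.

(** A root of [k1 X^2 + m X + k2] splits off a linear factor; for [k1 = 0] one factor is
    constant. *)
Lemma quadratic_form_factor (F : numClosedFieldType) (k1 m k2 : F) :
  exists g1 h1 g2 h2 : F, [/\ g1 * g2 = k1, g1 * h2 + h1 * g2 = m & h1 * h2 = k2].
Proof.
have [->|nz1] := eqVneq k1 0.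
  by exists 0, 1, m, k2; rewrite !mul0r !mul1r add0r.
pose s := sqrtC (m ^+ 2 - 4%:R * k1 * k2).
pose x := (s - m) / (2%:R * k1).
have two0 : 2%:R != 0 :> F by rewrite pnatr_eq0.
have xE : k1 * x ^+ 2 + m * x + k2 = 0.
  have s2 : s ^+ 2 = m ^+ 2 - 4%:R * k1 * k2 by rewrite sqrtCK.
  have -> : k1 * x ^+ 2 + m * x + k2 = (s ^+ 2 - m ^+ 2 + 4%:R * k1 * k2) / (4%:R * k1).
    by rewrite /x; field; rewrite nz1.
  by rewrite s2; field.
exists 1, (- x), k1, (m + k1 * x); split; try by ring.
by rewrite -[RHS]subr0 -xE; ring.
Qed.

Lemma segre_det_conj (F : fieldType) n (G A B C D A' B' C' D' : 'M[F]_n) :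
  \det G != 0 -> G *m A = A' *m G -> G *m B = B' *m G -> G *m C = C' *m G ->
  G *m D = D' *m G -> segre_det A' B' C' D' -> segre_det A B C D.
Proof.
move=> nzG GA GB GC GD H x1 x2 x3 x4 x14.
have dE (M M' : 'M[F]_n) : G *m M = M' *m G -> \det M = \det M'.
  move=> GM; apply: (mulfI nzG); rewrite -det_mulmx GM det_mulmx; exact: mulrC.
rewrite (dE _ _ GA) (dE _ _ GB) (dE _ _ GC) (dE _ _ GD) -H //; apply: dE.
by rewrite !mulmxDr !mulmxDl -!scalemxAr -!scalemxAl GA GB GC GD.
Qed.

Lemma val_ord_pred n (i : 'I_n) : (0 < i)%N -> ord_pred i = i.-1 :> nat.
Proof.
move=> i_gt0 /=; have := ltn_ord i; case: (nat_of_ord i) i_gt0 => // k _ kn.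
by rewrite addSn /= modnDr modn_small // ltnW.
Qed.

(** The partial products of [r] solve the recursion; at index 0 it refers back to the last one, the
    full product, which is 1. *)
Lemma cyclic_gauge (F : fieldType) n (r : 'I_n -> F) : \prod_i r i = 1 ->
  exists2 g : 'I_n -> F, forall i, g i != 0 & forall i, g i = r i * g (ord_pred i).
Proof.
move=> r1; have nzr i : r i != 0.
  by apply: contra_eq_neq r1 => /eqP ri; rewrite (bigD1 i) //= (eqP ri) mul0r eq_sym oner_eq0.
exists (fun i => \prod_(j < n | (j <= i)%N) r j) => i.
  by rewrite prodf_seq_neq0; apply/allP => j _; apply/implyP => _.
rewrite (bigD1 i) //=; congr (_ * _).
case: (posnP i) => [i0|i_gt0].
  rewrite big1 => [|j]; last first.
    by rewrite i0 leqn0 -val_eqE /= => /andP [/eqP ->]; rewrite i0.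
  rewrite -[LHS]r1; apply: eq_bigl => j /=.
  have n_gt0 : (0 < n)%N by apply: leq_ltn_trans (ltn_ord i).
  by rewrite i0 add0n modn_small ?prednK // -ltnS prednK ?ltn_ord.
apply: eq_bigl => j /=; have /= -> := val_ord_pred i_gt0.
by rewrite -val_eqE /=; lia.
Qed.

(** * Clock and shift matrices *)

Section CyclicMatrices.
Variables (R : comUnitRingType) (n : nat).

(** This is the support pattern of the operator [B]; its transpose is that of [C]. *)
Definition shift_mx : 'M[R]_n := perm_mx (perm (@ord_pred_inj n)).

Definition geo_mx (z : R) : 'M[R]_n := diag_mx (\row_i z ^+ i).

Lemma shift_mx_tr : shift_mx *m shift_mx^T = 1%:M.
Proof. by rewrite tr_perm_mx -perm_mxM mulgV perm_mx1. Qed.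

Lemma geo_mxV z : z \is a GRing.unit -> geo_mx z *m geo_mx z^-1 = 1%:M.
Proof.
move=> uz; rewrite mulmx_diag -[RHS]diag_const_mx; congr diag_mx.
by apply/rowP => i; rewrite !mxE exprVn divrr // unitrX.
Qed.

Lemma geo_shift_comm z : z ^+ n = 1 ->
  geo_mx z *m shift_mx = z *: (shift_mx *m geo_mx z).
Proof.
move=> zn; apply/matrixP => i j.
rewrite mul_diag_mx mul_mx_diag !mxE permE.
case: eqP => [<-|]; rewrite ?mulr0 ?mul0r ?mulr0 // mulr1 mul1r -exprS /=.
(* At the wrap-around the exponents differ by [n], which is where [z ^+ n = 1] enters. *)
case: (posnP i) => [->|i_gt0].
  have n_gt0 : (0 < n)%N by apply: leq_ltn_trans (ltn_ord i).
  by rewrite modn_small ?prednK //= expr0 zn.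
have /= -> := val_ord_pred i_gt0.
by rewrite prednK.
Qed.
End CyclicMatrices.

(** * Operators of the class in clock and shift form *)

Section ClassC.
Variables (F : numClosedFieldType) (n : nat) (q : F).
Hypothesis q_prim : n.-primitive_root q.
Hypothesis n_odd : odd n.
Let Z := geo_mx n q.
Let Z' := geo_mx n q^-1.
Let S := shift_mx F n.

(* Conjugating by a diagonal matrix changes [b] and [c] freely as long as the
   products [b_i c_i] and [\prod_i b_i] are kept, so [b_i] may be taken to be a
   linear factor of the quadratic form [b_i c_i] in [q^i], [q^-i]. *)
Lemma segre_det_nondeg a1 a2 d1 d2 Del (b c : 'rV[F]_n) :
  (forall i, b 0 i * c 0 i = Del + q * a2 * d2 * q ^- i ^+ 2 + a1 * d1 / q * q ^+ i ^+ 2) ->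
  (forall i, b 0 i * c 0 i != 0) ->
  segre_det (a1 *: Z + a2 *: Z') (diag_mx b *m S) (S^T *m diag_mx c) (d1 *: Z + d2 *: Z').
Proof.
move=> bcE nzbc; have n_gt0 := prim_order_gt0 q_prim.
have nzq : q != 0 by rewrite (prim_root_eq0 q_prim) -lt0n.
have [g1 [h1 [g2 [h2 [gg gh hh]]]]] := quadratic_form_factor (a1 * d1 / q) Del (q * a2 * d2).
pose y1 (i : 'I_n) := g1 * q ^+ i + h1 * q ^- i.
pose y2 (i : 'I_n) := g2 * q ^+ i + h2 * q ^- i.
have yE i : b 0 i * c 0 i = y1 i * y2 i.
  rewrite bcE -gg -gh -hh /y1 /y2; field; exact: expf_neq0.
have nzb i : b 0 i != 0 by have := nzbc i; rewrite mulf_eq0 => /norP [].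
have nzy1 i : y1 i != 0 by have := nzbc i; rewrite yE mulf_eq0 => /norP [].
(* The target entries are [be * y1 i] and [y2 i / be]; [be] is chosen so that the entries of [b]
   keep their product, as [cyclic_gauge] requires. *)
pose be := n.-root ((\prod_i b 0 i) / \prod_i y1 i).
have beE : be ^+ n = (\prod_i b 0 i) / \prod_i y1 i by rewrite rootCK.
have nz_prod (f : 'I_n -> F) : (forall i, f i != 0) -> \prod_i f i != 0.
  by move=> nzf; rewrite prodf_seq_neq0; apply/allP => j _; apply/implyP.
have nzbe : be != 0.
  have : be ^+ n != 0 by rewrite beE mulf_neq0 ?invr_eq0 ?nz_prod.
  by rewrite expf_eq0 n_gt0.
have [|g nzg gE] := @cyclic_gauge F n (fun i => be * y1 i / b 0 i).
  rewrite !big_split /= prodr_const card_ord beE prodfV divfK ?nz_prod //.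
  by rewrite divff ?nz_prod.
apply: (@segre_det_conj _ _ (diag_mx (\row_i g i)) _ _ _ _
  (a1 *: Z + a2 *: Z') (((be * g1) *: Z + (be * h1) *: Z') *m S)
  (S^T *m ((g2 / be) *: Z + (h2 / be) *: Z')) (d1 *: Z + d2 *: Z')).
- by rewrite det_diag nz_prod // => i; rewrite mxE.
- by rewrite mulmxDr mulmxDl -!scalemxAr -!scalemxAl !(diag_mxC _ (\row_i g i)).
- rewrite mulmxA mulmx_diag; apply/matrixP => i j.
  rewrite mul_diag_mx mul_mx_diag mulmxDl -!scalemxAl !mul_diag_mx !mxE permE.
  case: eqP => [<-|]; last by rewrite !(mulr0, mul0r, addr0).
  by rewrite !mulr1 gE /y1 exprVn; field; rewrite nzb expf_neq0.
- have cE j : c 0 j = y1 j * y2 j / b 0 j by rewrite -yE mulrAC divff ?mul1r.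
  apply/matrixP => i j.
  rewrite mul_mx_diag mul_diag_mx mulmxDr -!scalemxAr !mul_mx_diag !mxE permE.
  case: eqP => [<-|]; last by rewrite !(mulr0, mul0r, addr0).
  rewrite !mul1r (gE j) cE /y2 exprVn; field.
  by rewrite nzb nzbe expf_neq0.
- by rewrite mulmxDr mulmxDl -!scalemxAr -!scalemxAl !(diag_mxC _ (\row_i g i)).
apply: (weyl_segre_det q_prim n_odd (shift_mx_tr _ _) (geo_mxV _ _)
          (geo_shift_comm (prim_expr_order q_prim))).
- by rewrite unitfE.
- rewrite -[LHS](divfK nzq) -gg; field; exact: nzbe.
- by rewrite -hh; field; exact: nzbe.
Qed.

Lemma horner_det (p : 'M[{poly F}]_n) t :
  (\det p).[t] = \det (map_mx (horner_eval t) p).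
Proof. by rewrite det_map_mx. Qed.

(* Deform [b_i c_i] into [b_i c_i + t^2]; both sides are polynomials in [t] that
   agree for all but finitely many [t]. *)
Lemma segre_det_class a1 a2 d1 d2 Del (b c : 'rV[F]_n) :
  (forall i, b 0 i * c 0 i = Del + q * a2 * d2 * q ^- i ^+ 2 + a1 * d1 / q * q ^+ i ^+ 2) ->
  segre_det (a1 *: Z + a2 *: Z') (diag_mx b *m S) (S^T *m diag_mx c) (d1 *: Z + d2 *: Z').
Proof.
move=> bcE x1 x2 x3 x4 x14.
(* If one of [b_i], [c_i] is nonzero, it stays fixed and the other moves; if both vanish, both
   become [t]. The last case is why the deformation is by [t^2]. *)
have [bp [cp bcP]] : exists bp cp : 'I_n -> {poly F}, forall i,
    [/\ (bp i).[0] = b 0 i, (cp i).[0] = c 0 i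
      & forall t, (bp i).[t] * (cp i).[t] = b 0 i * c 0 i + t ^+ 2].
  have H i : exists bc : {poly F} * {poly F}, [/\ bc.1.[0] = b 0 i, bc.2.[0] = c 0 i
      & forall t, bc.1.[t] * bc.2.[t] = b 0 i * c 0 i + t ^+ 2].
    have [b0|nzb] := eqVneq (b 0 i) 0; last first.
      exists ((b 0 i)%:P, (c 0 i)%:P + (b 0 i)^-1 *: 'X^2); rewrite /=.
      split=> [||t]; rewrite !(hornerD, hornerZ, hornerC, hornerXn) ?expr0n ?mulr0 ?addr0 //.
      by field.
    have [c0|nzc] := eqVneq (c 0 i) 0; last first.
      exists ((b 0 i)%:P + (c 0 i)^-1 *: 'X^2, (c 0 i)%:P); rewrite /=.
      split=> [||t]; rewrite !(hornerD, hornerZ, hornerC, hornerXn) ?expr0n ?mulr0 ?addr0 //.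
      by field.
    exists ('X, 'X); rewrite /= b0 c0.
    by split=> [||t]; rewrite hornerX // mul0r add0r.
  have [f fP] := fin_all_exists H.
  by exists (fun i => (f i).1), (fun i => (f i).2) => i; have [] := fP i.
pose Bt (t : F) := diag_mx (\row_i (bp i).[t]) *m S.
pose Ct (t : F) := S^T *m diag_mx (\row_i (cp i).[t]).
set A := a1 *: Z + a2 *: Z'; set D := d1 *: Z + d2 *: Z'.
pose cst (M : 'M[F]_n) : 'M[{poly F}]_n := map_mx polyC M.
pose BP := diag_mx (\row_i bp i) *m cst S.
pose CP := cst S^T *m diag_mx (\row_i cp i).
pose p : {poly F} := \det (x1%:P *: cst A + x2%:P *: BP + x3%:P *: CP + x4%:P *: cst D)
  - ((x1 ^+ n)%:P * \det (cst A) + (x2 ^+ n)%:P * \det BP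
     + (x3 ^+ n)%:P * \det CP + (x4 ^+ n)%:P * \det (cst D)).
have cstE t M : map_mx (horner_eval t) (cst M) = M.
  by apply/matrixP => i j; rewrite !mxE; exact: hornerC.
have evalZ t x (M : 'M[{poly F}]_n) :
  map_mx (horner_eval t) (x%:P *: M) = x *: map_mx (horner_eval t) M.
  by apply/matrixP => i j; rewrite !mxE /horner_eval hornerCM.
have BPE t : map_mx (horner_eval t) BP = Bt t.
  rewrite map_mxM map_diag_mx cstE; congr (diag_mx _ *m _).
  by apply/rowP => i; rewrite !mxE.
have CPE t : map_mx (horner_eval t) CP = Ct t.
  rewrite map_mxM map_diag_mx cstE; congr (_ *m diag_mx _).
  by apply/rowP => i; rewrite !mxE.
have pE t : p.[t] = \det (x1 *: A + x2 *: Bt t + x3 *: Ct t + x4 *: D)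
  - (x1 ^+ n * \det A + x2 ^+ n * \det (Bt t) + x3 ^+ n * \det (Ct t) + x4 ^+ n * \det D).
  rewrite /p !(hornerD, hornerN, hornerM, hornerC) !horner_det.
  by rewrite !map_mxD !evalZ !cstE BPE CPE.
(* The roots of [r] are the parameters at which some deformed product vanishes; elsewhere the
   nondegenerate case applies, so [p * r] vanishes at every natural number. *)
pose r : {poly F} := \prod_i ('X^2 + (b 0 i * c 0 i)%:P).
have nzr : r != 0.
  rewrite prodf_seq_neq0; apply/allP => i _; apply/implyP => _.
  by rewrite -size_poly_eq0 size_XnaddC.
have /eqP : p * r = 0.
  apply: poly_eq0_nat => k; rewrite hornerM.
  have [->|nzk] := eqVneq r.[k%:R] 0; first by rewrite mulr0.
  suff -> : p.[k%:R] = 0 by rewrite mul0r.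
  rewrite pE; apply/eqP; rewrite subr_eq0; apply/eqP.
  (* Adding the same [t^2] to every product only shifts the constant [Del]. *)
  apply: (@segre_det_nondeg _ _ _ _ (Del + k%:R ^+ 2)) => // i; rewrite !mxE;
    have [_ _ ->] := bcP i.
    by rewrite bcE; ring.
  move: nzk; rewrite horner_prod prodf_seq_neq0 => /allP /(_ i).
  by rewrite mem_index_enum /= !(hornerD, hornerXn, hornerC) addrC => ->.
rewrite mulf_eq0 (negPf nzr) orbF => /eqP p0.
have := pE 0; rewrite p0 horner0 => /esym/eqP; rewrite subr_eq0 => /eqP.
have -> : Bt 0 = diag_mx b *m S.
  by congr (diag_mx _ *m _); apply/rowP => i; rewrite mxE; have [] := bcP i.
have -> : Ct 0 = S^T *m diag_mx c.
  by congr (_ *m diag_mx _); apply/rowP => i; rewrite mxE; have [] := bcP i.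
by [].
Qed.
End ClassC.

(** * Products over roots of unity *)

(** Evaluate the factorization of [X^n - 1] at [- (a / b)] and multiply by [(- b) ^+ n]; odd [n]
    turns the difference into a sum. *)
Lemma sum_pow_factor (F : fieldType) n (w a b : F) :
  odd n -> n.-primitive_root w ->
  a ^+ n + b ^+ n = \prod_(k < n) (a + w ^+ k * b).
Proof.
move=> n_odd w_prim; have n_gt0 := prim_order_gt0 w_prim.
have [->|nzb] := eqVneq b 0.
  rewrite expr0n gtn_eqF // addr0.
  by under eq_bigr do rewrite mulr0 addr0; rewrite prodr_const card_ord.
have := congr1 (horner^~ (- (a / b))) (factor_Xn_sub_1 w_prim).
rewrite big_mkord horner_prod !hornerE exprNn -signr_odd n_odd expr1 => H.
have -> : a ^+ n + b ^+ n = (- b) ^+ n * (-1 * (a / b) ^+ n - 1).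
  rewrite exprNn -signr_odd n_odd expr1 expr_div_n; field; exact: expf_neq0.
rewrite -H -[n in (- b) ^+ n]card_ord -prodr_const -big_split /=.
by apply: eq_bigr => k _; rewrite !hornerE; field.
Qed.

(* Writing [f], [g] as n-th powers, [p^n f + q^n g] splits into the factors
   [p x + q w^k y], and the two products may be exchanged. *)
Lemma prod_norm_form (F : numClosedFieldType) n (w : F) (l : seq (F * F)) E H f g :
  odd n -> n.-primitive_root w ->
  (forall x y, \prod_(pq <- l) (pq.1 * x + pq.2 * y) = E * x ^+ n + H * y ^+ n) ->
  \prod_(pq <- l) (pq.1 ^+ n * f + pq.2 ^+ n * g) = (E * f + H * g) ^+ n.
Proof.
move=> n_odd w_prim lE; have n_gt0 := prim_order_gt0 w_prim.
rewrite -(rootCK n_gt0 f) -(rootCK n_gt0 g).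
move: (n.-root f) (n.-root g) => {}f {}g.
under eq_bigr => pq _ do rewrite -!exprMn (sum_pow_factor _ _ n_odd w_prim).
rewrite exchange_big /= (eq_bigr (fun=> E * f ^+ n + H * g ^+ n)) => [|k _].
  by rewrite prodr_const card_ord.
(* The root of unity disappears in the n-th power, so all [n] inner products have the same value. *)
have -> : g ^+ n = (w ^+ k * g) ^+ n.
  by rewrite exprMn exprAC (prim_expr_order w_prim) expr1n mul1r.
rewrite -lE.
by apply: eq_bigr => pq _; ring.
Qed.

(** * The complex exponential and its primitive root *)

Section Trig.
Variable R : realType.
Local Notation C := R[i].
Local Open Scope complex_scope.

(** This is [e^(i z)]. *)
Definition cexpi (z : C) : C :=
  (expR (- complex.Im z) * cos (complex.Re z)) +i* (expR (- complex.Im z) * sin (complex.Re z)).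

Lemma cexpiD z w : cexpi (z + w) = cexpi z * cexpi w.
Proof.
case: z w => [a b] [c d]; apply/eqP; rewrite eq_complex /=.
by rewrite opprD expRD cosD sinD; apply/andP; split; apply/eqP; ring.
Qed.

Lemma cexpi0 : cexpi 0 = 1.
Proof. by rewrite /cexpi /= oppr0 expR0 cos0 sin0 mulr0 mulr1. Qed.

Lemma cexpi_neq0 z : cexpi z != 0.
Proof.
have : cexpi z * cexpi (- z) != 0 by rewrite -cexpiD subrr cexpi0 oner_neq0.
by rewrite mulf_eq0 => /norP [].
Qed.

Lemma cexpiN z : cexpi (- z) = (cexpi z)^-1.
Proof.
by apply: (mulfI (cexpi_neq0 z)); rewrite -cexpiD subrr cexpi0 divff ?cexpi_neq0.
Qed.

Lemma cexpiMn z k : cexpi (z * k%:R) = cexpi z ^+ k.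
Proof.
elim: k => [|k IHk]; first by rewrite mulr0 cexpi0.
by rewrite -natr1 mulrDr mulr1 cexpiD IHk exprSr.
Qed.

Lemma ccosE z : ccos z = (cexpi z + (cexpi z)^-1) / 2.
Proof.
rewrite -cexpiN; apply: (mulIf (x := 2)); rewrite ?pnatr_eq0 // divfK ?pnatr_eq0 //.
case: z => [a b]; rewrite mulr_natr mulr2n; apply/eqP.
rewrite eq_complex /= /rcosh /rsinh cosN sinN opprK.
by apply/andP; split; apply/eqP; field.
Qed.

Lemma csinE z : csin z = (cexpi z - (cexpi z)^-1) / (2 * 'i).
Proof.
have nz2i : 2 * 'i != 0 :> C by rewrite mulf_neq0 ?pnatr_eq0 // eq_complex /= oner_eq0 andbF.
rewrite -cexpiN; apply: (mulIf nz2i); rewrite divfK //.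
case: z => [a b]; rewrite mulr_natl mulr2n; apply/eqP.
rewrite eq_complex /= /rcosh /rsinh cosN sinN opprK.
by apply/andP; split; apply/eqP; field.
Qed.

Lemma cexpi_2eta_prim (m : int) n : (0 < n)%N -> coprime `|m|%N n ->
  n.-primitive_root (cexpi (2 * Defs.eta R m n)).
Proof.
move=> n_gt0 co_mn; have nzn : n%:R != 0 :> R by rewrite pnatr_eq0 -lt0n.
pose t : R := pi *+ 2 / n%:R; pose w := cexpi t%:C.
have wE k : w ^+ k = (cos (t * k%:R)) +i* (sin (t * k%:R)).
  rewrite -cexpiMn -[k%:R in LHS](rmorph_nat (real_complex R)) -rmorphM /cexpi /=.
  by rewrite oppr0 expR0 !mul1r.
have w_prim : n.-primitive_root w.
  have wn : w ^+ n = 1 by rewrite wE /t divfK // cos2pi sin2pi.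
  (* An order [k < n] would give [cos (2 pi k / n) = 1], hence [sin (pi k / n) = 0] although
     [0 < pi k / n < pi]. *)
  have [k k_prim /dvdn_leq] := prim_order_exists n_gt0 wn.
  move=> /(_ n_gt0); rewrite leq_eqVlt => /orP [/eqP <- //|kn].
  have := prim_expr_order k_prim; rewrite wE => -[ck _].
  have k_gt0 := prim_order_gt0 k_prim.
  have : 0 < sin (pi * (k%:R / n%:R) : R).
    apply: sin_gt0_pi; rewrite mulr_gt0 ?pi_gt0 ?divr_gt0 ?ltr0n //=.
    by rewrite gtr_pMr ?pi_gt0 // ltr_pdivrMr ?ltr0n // mul1r ltr_nat.
  move: ck; have -> : t * k%:R = (pi * (k%:R / n%:R)) *+ 2 by rewrite /t; field.
  rewrite cos_mulr2n cos2sin2 => c1; have : sin (pi * (k%:R / n%:R) : R) ^+ 2 = 0 by lra.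
  by move=> /eqP; rewrite sqrf_eq0 => /eqP ->; rewrite ltxx.
(* This serves negative [m], where [e^(2 i eta)] is a natural power of [w^-1]. *)
have w'_prim : n.-primitive_root w^-1.
  have -> : w^-1 = w ^+ n.-1.
    apply: (mulfI (cexpi_neq0 t%:C)); rewrite divff ?cexpi_neq0 // -exprS prednK //.
    by rewrite prim_expr_order.
  by rewrite (prim_root_exp_coprime _ w_prim) coprimePn.
have -> : 2 * Defs.eta R m n = t%:C * m%:~R.
  rewrite /Defs.eta -(rmorph_nat (real_complex R) 2) -(rmorph_int (real_complex R)).
  by rewrite -!rmorphM /t; congr (_ %:C); field.
case: m co_mn => k co.
  by rewrite -pmulrn cexpiMn (prim_root_exp_coprime _ w_prim).
by rewrite NegzE mulrNz mulrN cexpiN -pmulrn cexpiMn -exprVn (prim_root_exp_coprime _ w'_prim).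
Qed.
End Trig.

(** * Pencil identities and trigonometric coefficients *)

Lemma tens_pencil_mul (F : comPzRingType) N1 N2 (A1 B1 C1 D1 : 'M[F]_N1)
    (A2 B2 C2 D2 : 'M[F]_N2) p q u1 u2 :
  p *: (u1 *: (A1 *t A2 + B1 *t C2) + u2 *: (A1 *t B2 + B1 *t D2))
  + q *: (u1 *: (C1 *t A2 + D1 *t C2) + u2 *: (C1 *t B2 + D1 *t D2))
  = (p *: A1 + q *: C1) *t (u1 *: A2 + u2 *: B2)
    + (p *: B1 + q *: D1) *t (u1 *: C2 + u2 *: D2).
Proof. by apply/matrixP => i j; rewrite !mxE; ring. Qed.

Lemma pairing_expand (F : comPzRingType) N (A B C D : 'M[F]_N) p q u1 u2 :
  p *: (u1 *: A + u2 *: B) + q *: (u1 *: C + u2 *: D)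
  = (p * u1) *: A + (p * u2) *: B + (q * u1) *: C + (q * u2) *: D.
Proof. by rewrite !scalerDr !scalerA addrA. Qed.

Lemma tens_pencil1 (F : comPzRingType) N (A B C D : 'M[F]_N) p q u1 u2 :
  (p *: A + q *: C) *t (u1 *: 1%:M + u2 *: 0)
    + (p *: B + q *: D) *t (u1 *: 0 + u2 *: 1%:M)
  = (p *: (u1 *: A + u2 *: B) + q *: (u1 *: C + u2 *: D)) *t (1%:M : 'M[F]_1).
Proof. by apply/matrixP => i j; rewrite !mxE; ring. Qed.

Lemma geo_mx_comb (F : comUnitRingType) n (q a1 a2 : F) :
  a1 *: geo_mx n q + a2 *: geo_mx n q^-1
  = diag_mx (\row_i (a1 * q ^+ i + a2 * q ^- i)).
Proof.
rewrite /geo_mx -!linearZ -linearD /=; congr diag_mx.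
by apply/rowP => i; rewrite !mxE exprVn.
Qed.

Lemma diag_shift_mx (F : comUnitRingType) n (b : 'I_n -> F) :
  diag_mx (\row_i b i) *m shift_mx F n
  = \matrix_(i, j) (if val j == ((val i + n.-1) %% n)%N then b i else 0).
Proof.
apply/matrixP => i j; rewrite mul_diag_mx !mxE permE eq_sym -val_eqE /=.
have n_gt0 : (0 < n)%N by apply: leq_ltn_trans (ltn_ord i).
by rewrite -subn1 -addnBA // subn1; case: eqP; rewrite ?mulr1 ?mulr0.
Qed.

Lemma tr_shift_diag_mx (F : comUnitRingType) n (c : 'I_n -> F) :
  (shift_mx F n)^T *m diag_mx (\row_i c i)
  = \matrix_(i, j) (if val i == ((val j + n.-1) %% n)%N then c j else 0).
Proof.
apply/matrixP => i j; rewrite mul_mx_diag !mxE permE eq_sym -val_eqE /=.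
have n_gt0 : (0 < n)%N by apply: leq_ltn_trans (ltn_ord i).
by rewrite -subn1 -addnBA // subn1; case: eqP; rewrite ?mul1r ?mul0r.
Qed.

Lemma sin_diag_coef (F : numFieldType) (I a z t : F) : I != 0 -> z != 0 -> t != 0 ->
  a * ((z * t^-1 - (z * t^-1)^-1) / (2 * I))
  = - (a / (2 * I * z)) * t + a * z / (2 * I) * t^-1.
Proof. by move=> *; field; rewrite ?mulf_neq0 ?pnatr_eq0 //; do ?[apply/andP; split]. Qed.

(** With [t = q ^+ i], this turns the cosine in [b_i c_i] into the form with coefficients
    [q * a2 * d2] and [a1 * d1 / q] required by [segre_det_class]. *)
Lemma cos_weight_coef (F : numFieldType) (I a d z w q t : F) :
  I ^+ 2 = -1 -> z != 0 -> w != 0 -> q != 0 -> t != 0 ->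
  let k := z * w^-1 * q * (t ^+ 2)^-1 in
  a * d / 2 * ((k + k^-1) / 2)
  = q * (a * z / (2 * I)) * (- (d / (2 * I * w))) * t^-1 ^+ 2
    + - (a / (2 * I * z)) * (d * w / (2 * I)) / q * t ^+ 2.
Proof.
move=> I2 nzz nzw nzq nzt k.
have nzI : I != 0 by rewrite -sqrf_eq0 I2 oppr_eq0 oner_eq0.
have -> : q * (a * z / (2 * I)) * (- (d / (2 * I * w))) * t^-1 ^+ 2
    + - (a / (2 * I * z)) * (d * w / (2 * I)) / q * t ^+ 2
  = - (q * a * z * d / (4 * w) * t^-1 ^+ 2 + a * d * w / (4 * z) / q * t ^+ 2) / I ^+ 2.
  by field; rewrite nzz nzw nzq nzt nzI.
by rewrite I2 /k; field; rewrite nzz nzw nzq nzt.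
Qed.

(** * Vacuum determinants of monodromy matrices *)

Section Monodromy.
Variable R : realType.
Local Notation C := R[i].

Definition pairing N (X : Quad R N) (p q u1 u2 : C) : 'M[C]_N :=
  p *: (u1 *: qA X + u2 *: qB X) + q *: (u1 *: qC X + u2 *: qD X).

(** The matrix [M] is paired with the row [(p^n, q^n)] and the column [(u1^n, u2^n)], parallel to
    [pairing]. *)
Definition curve_eq n (M : 'M[C]_2) (p q u1 u2 : C) : C :=
  p ^+ n * (ent00 M * u1 ^+ n + ent01 M * u2 ^+ n)
  + q ^+ n * (ent10 M * u1 ^+ n + ent11 M * u2 ^+ n).

Lemma pairing_qmul N1 N2 (X : Quad R N1) (Y : Quad R N2) p q u1 u2 :
  pairing (qmul X Y) p q u1 u2
  = (p *: qA X + q *: qC X) *t (u1 *: qA Y + u2 *: qB Y)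
    + (p *: qB X + q *: qD X) *t (u1 *: qC Y + u2 *: qD Y).
Proof. exact: tens_pencil_mul. Qed.

Lemma pairing_castQ N1 N2 (e : N1 = N2) (X : Quad R N1) p q u1 u2 :
  \det (pairing (castQ e X) p q u1 u2) = \det (pairing X p q u1 u2).
Proof. by case: N2 / e; rewrite /pairing /= !castmx_id. Qed.

Lemma vacdetE N (X : Quad R N) u v : vacdet X u v = \det (pairing X 1 (- v) u 1).
Proof.
rewrite /vacdet /pairing !scale1r scalerDr !scalerA mulrC scaleNr mulNr scaleNr.
by rewrite [v * u]mulrC addrA.
Qed.

Lemma ent_mul (M1 M2 : 'M[C]_2) :
  [/\ ent00 (M1 *m M2) = ent00 M1 * ent00 M2 + ent01 M1 * ent10 M2,
      ent01 (M1 *m M2) = ent00 M1 * ent01 M2 + ent01 M1 * ent11 M2,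
      ent10 (M1 *m M2) = ent10 M1 * ent00 M2 + ent11 M1 * ent10 M2
    & ent11 (M1 *m M2) = ent10 M1 * ent01 M2 + ent11 M1 * ent11 M2].
Proof.
by split; rewrite /ent00 /ent01 /ent10 /ent11 mxE !big_ord_recl big_ord0 addr0;
  congr (_ * _ + _ * _); congr (fun_of_matrix _ _ _); apply: val_inj.
Qed.

Lemma det_pairing_qmul n N (X : Quad R n) (Y : Quad R N) M1 M2 K (w : C) :
  odd n -> n.-primitive_root w ->
  (forall p q u1 u2, \det (pairing X p q u1 u2) = curve_eq n M1 p q u1 u2) ->
  (forall p q u1 u2, \det (pairing Y p q u1 u2) = curve_eq n M2 p q u1 u2 ^+ K) ->
  forall p q u1 u2,
    \det (pairing (qmul X Y) p q u1 u2) = curve_eq n (M1 *m M2) p q u1 u2 ^+ (n * K).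
Proof.
move=> n_odd w_prim XE YE p q u1 u2; rewrite pairing_qmul.
have [l _ [lE ->]] := det_tens_pencil (p *: qA X + q *: qC X) (p *: qB X + q *: qD X).
pose f := ent00 M2 * u1 ^+ n + ent01 M2 * u2 ^+ n.
pose g := ent10 M2 * u1 ^+ n + ent11 M2 * u2 ^+ n.
under eq_bigr => pq _ do rewrite -/(pairing Y pq.1 pq.2 u1 u2) YE /curve_eq.
rewrite -/f -/g prodrXl.
(* The coefficients [E] and [H] form the row [(p^n, q^n)] times [M1]; pairing it with [(f, g)],
   which is [M2] times the column [(u1^n, u2^n)], produces [M1 *m M2]. *)
rewrite (@prod_norm_form _ _ _ _ (p ^+ n * ent00 M1 + q ^+ n * ent10 M1)
  (p ^+ n * ent01 M1 + q ^+ n * ent11 M1) _ _ n_odd w_prim) => [|x y].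
  rewrite -exprM; congr (_ ^+ _); have [e00 e01 e10 e11] := ent_mul M1 M2.
  by rewrite /curve_eq e00 e01 e10 e11 /f /g; ring.
rewrite -lE; have := XE p q x y.
have -> : pairing X p q x y = x *: (p *: qA X + q *: qC X) + y *: (p *: qB X + q *: qD X).
  rewrite /pairing !scalerDr !scalerA ![x * _]mulrC ![y * _]mulrC -!addrA.
  by congr (_ + _); rewrite addrCA.
by move=> ->; rewrite /curve_eq; ring.
Qed.

Lemma pairing_qmul_Quad1 N (X : Quad R N) p q u1 u2 :
  \det (pairing (qmul X (Quad1 R)) p q u1 u2) = \det (pairing X p q u1 u2).
Proof.
rewrite -[RHS]expr1 -det_tensmx1; congr (\det _).
by rewrite pairing_qmul; exact: tens_pencil1.
Qed.

Lemma det_pairing_Lop (m : int) n (p : CData R n) lam :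
  odd n -> coprime `|m|%N n -> classC m p ->
  forall a b u1 u2,
    \det (pairing (Lop m p lam) a b u1 u2) = curve_eq n (ML m p lam) a b u1 u2.
Proof.
move=> n_odd co_mn Cp a b u1 u2; have n_gt0 := odd_gt0 n_odd.
have q_prim := cexpi_2eta_prim R n_gt0 co_mn.
set q := cexpi _ in q_prim.
pose et := Defs.eta R m n.
(* [z] and [w] are the exponentials of the phases of [A] and [D] at index 0. *)
pose z := cexpi (lam + crho p + (n%:R - 1) * et).
pose w := cexpi (lam + csig p - (n%:R - 1) * et).
have nzz : z != 0 := cexpi_neq0 _.
have nzw : w != 0 := cexpi_neq0 _.
have nzq : q != 0 := cexpi_neq0 _.
have nzi : 'i != 0 :> C by rewrite eq_complex /= oner_eq0 andbF.
have i2 : 'i ^+ 2 = -1 :> C by exact: sqr_i.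
pose a1 := - (ca p / (2 * 'i * z)). pose a2 := ca p * z / (2 * 'i).
pose d1 := cd p * w / (2 * 'i). pose d2 := - (cd p / (2 * 'i * w)).
have AE : qA (Lop m p lam) = a1 *: geo_mx n q + a2 *: geo_mx n q^-1.
  rewrite geo_mx_comb; congr diag_mx; apply/rowP => i; rewrite [LHS]mxE [RHS]mxE csinE.
  have -> : lam + crho p + (n%:R - 1 - 2 * (val i)%:R) * Defs.eta R m n
     = lam + crho p + (n%:R - 1) * et - 2 * Defs.eta R m n * (val i)%:R.
    by rewrite /et; ring.
  rewrite cexpiD cexpiN cexpiMn -/z -/q /a1 /a2.
  by apply: sin_diag_coef => //; apply: expf_neq0.
have DE : qD (Lop m p lam) = d1 *: geo_mx n q + d2 *: geo_mx n q^-1.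
  rewrite geo_mx_comb; congr diag_mx; apply/rowP => i; rewrite [LHS]mxE [RHS]mxE csinE.
  have -> : lam + csig p + (2 * (val i)%:R + 1 - n%:R) * Defs.eta R m n
     = lam + csig p - (n%:R - 1) * et + 2 * Defs.eta R m n * (val i)%:R.
    by rewrite /et; ring.
  rewrite cexpiD cexpiMn -/w -/q /d1 /d2.
  (* The phase of [D] runs opposite to that of [A], so the same formula is used with
     [t = q ^- i]. *)
  rewrite -[q ^+ i]invrK sin_diag_coef ?invr_eq0 ?expf_neq0 // addrC invrK.
  by [].
have BE : qB (Lop m p lam) = diag_mx (\row_i cb p i) *m shift_mx C n.
  by rewrite diag_shift_mx.
have CE : qC (Lop m p lam) = (shift_mx C n)^T *m diag_mx (\row_i cc p i).
  by rewrite tr_shift_diag_mx.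
have /(_ (a * u1) (a * u2) (b * u1) (b * u2)) : segre_det (qA (Lop m p lam)) (qB (Lop m p lam))
    (qC (Lop m p lam)) (qD (Lop m p lam)).
  rewrite AE BE CE DE; apply: (@segre_det_class _ _ _ q_prim n_odd _ _ _ _ (cDel p)) => i.
  have -> : (\row_j cb p j) 0 i = cb p i by rewrite mxE.
  have -> : (\row_j cc p j) 0 i = cc p i by rewrite mxE.
  rewrite Cp ccosE.
  have -> : crho p - csig p + 2 * Defs.eta R m n * (n%:R - 2 * (val i)%:R)
     = (lam + crho p + (n%:R - 1) * et) - (lam + csig p - (n%:R - 1) * et)
       + 2 * Defs.eta R m n - 2 * Defs.eta R m n * (val i)%:R * 2%:R.
    by rewrite /et; ring.
  rewrite [cexpi (_ - _ + _ - _)]cexpiD cexpiN 2!cexpiMn.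
  rewrite [cexpi (_ - _ + _)]cexpiD [cexpi (_ - _)]cexpiD cexpiN -/z -/w -/q.
  rewrite -addrA; congr (_ + _); apply: cos_weight_coef => //; exact: expf_neq0.
have x14 : a * u1 * (b * u2) = a * u2 * (b * u1) by ring.
move=> /(_ x14); rewrite -pairing_expand => ->.
rewrite /curve_eq.
have [-> -> -> ->] : [/\ ent00 (ML m p lam) = \det (qA (Lop m p lam)),
    ent01 (ML m p lam) = \det (qB (Lop m p lam)), ent10 (ML m p lam) = \det (qC (Lop m p lam))
  & ent11 (ML m p lam) = \det (qD (Lop m p lam))].
  by split; rewrite [LHS]mxE.
rewrite !exprMn; move: (\det (qA _)) (\det (qB _)) (\det (qC _)) (\det (qD _)) => *.
by ring.
Qed.

(** The induction starts from one factor, with exponent 1, since the empty product has determinant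
    [p * u1 + q * u2], without n-th powers. Each further factor multiplies the exponent by [n]. *)
Lemma det_pairing_mono (m : int) n (ls : seq (CData R n * C)) :
  odd n -> coprime `|m|%N n -> (0 < size ls)%N ->
  (forall pl, List.In pl ls -> classC m pl.1) ->
  forall lam p q u1 u2,
    \det (pairing (mono m ls lam) p q u1 u2)
    = curve_eq n (Mprod m ls lam) p q u1 u2 ^+ (n ^ (size ls).-1).
Proof.
move=> n_odd co_mn + + lam; have q_prim := cexpi_2eta_prim R (odd_gt0 n_odd) co_mn.
elim: ls => [//|[d l] [|d' ls] IH] _ Hls p q u1 u2.
  rewrite /= pairing_castQ pairing_qmul_Quad1 mulmx1 expn0 expr1.
  by apply: det_pairing_Lop => //; apply: (Hls (d, l)); left.
transitivity (curve_eq n (ML m d (l + lam) *m Mprod m (d' :: ls) lam) p q u1 u2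
  ^+ (n * n ^ size ls)); last by rewrite -expnS.
rewrite -(det_pairing_qmul n_odd q_prim (X := Lop m d (l + lam))
  (Y := mono m (d' :: ls) lam)) => [|a b v1 v2|a b v1 v2].
- exact: pairing_castQ.
- by apply: det_pairing_Lop => //; apply: (Hls (d, l)); left.
- by apply: IH => // pl Hpl; apply: Hls; right.
Qed.
End Monodromy.

Unset Implicit Arguments.
Set Strict Implicit.

(* ls = [:: (p_1, lam_1); ...; (p_M, lam_M)] : constants of the L-operators
   L^(1), ..., L^(M) of the class 𝔆 together with the shifts lam_i. *)
Theorem theorem2 (R : realType) (m : int) (n : nat) (ls : seq (CData R n * R[i])) :
  odd n ->
  coprime `|m|%N n ->
  (0 < size ls)%N ->
  (forall pl, List.In pl ls -> classC m pl.1) ->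
  (forall pl, List.In pl ls -> exists mu : R[i], \det (ML m pl.1 mu) != 0) ->
  exists K : nat, (0 < K)%N /\
    forall lam : R[i],
      let X := Mprod m ls lam in
      exists c : R[i], c != 0 /\
        forall u v : R[i],
          vacdet (mono m ls lam) u v =
          c * ((ent10 X * u ^+ n + ent11 X) * v ^+ n
               - (ent00 X * u ^+ n + ent01 X)) ^+ K.
Proof.
move=> n_odd co_mn ls_gt0 Hls _.
exists (n ^ (size ls).-1)%N; split; first by rewrite expn_gt0 odd_gt0.
(* For odd [n], [(- v) ^+ n = - v ^+ n], so [curve_eq] is the negative of the stated base; the
   constant collects these signs. *)
move=> lam X; exists ((-1) ^+ (n ^ (size ls).-1)); split; first by rewrite signr_eq0.
move=> u v; rewrite vacdetE (det_pairing_mono n_odd co_mn ls_gt0 Hls) -exprMn.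
congr (_ ^+ _); rewrite /curve_eq -/X exprNn -signr_odd n_odd expr1 !expr1n; ring.
Qed.
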